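(* Let $\phi(x)=1/\sqrt{x^2-1}$ and $n\ge1$. Then $$\phi(a_i)=\left(\frac{U_{n-1}}{T_n}\right)(a_i)\qquad\text{and}\qquad \phi'(a_i)=\left(\frac{U_{n-1}}{T_n}\right)'(a_i)$$ for each $i=1,\dots,n$. In other words, $U_{n-1}/T_n$ is a multipoint Padé approximant of type $[n-1/n]$ to $\phi$ at the points $\{a_1,a_1,a_2,a_2,\dots,a_n,a_n\}$.
   Context: Let $\{a_k\}_{k=1}^\infty$ be a sequence of distinct points of $\mathbb{C}\setminus[-1,1]$. The symbol $\sqrt{x^2-1}$ denotes the branch analytic on $\mathbb{C}\setminus[-1,1]$ with $\sqrt{x^2-1}\sim x$ as $x\to\infty$. Put $c_k=a_k-\sqrt{a_k^2-1}$, so $0<|c_k|<1$ and $a_k=\frac12(c_k+c_k^{-1})$. Define $f_n(z)=\prod_{k=1}^n\frac{z-c_k}{1-c_kz}$ (no complex conjugation). With $x=\frac12(z+z^{-1})$, the Chebyshev rational functions are the rational functions of $x$ $$T_n(x)=\frac12\left(f_n(z)+\frac1{f_n(z)}\right),\qquad U_n(x)=\frac{1}{z-z^{-1}}\left(f_{n+1}(z)-\frac{1}{f_{n+1}(z)}\right),$$ which are well defined since both expressions are invariant under $z\mapsto 1/z$. The quotient $U_{n-1}/T_n$ is regarded as a rational function (after cancellation of the common poles at the $a_k$). A multipoint Padé approximant of type $[L/M]$ to a function $\phi$ at points $\{b_1,\dots,b_{L+M+1}\}$ is a ratio $Q/P$ of polynomials $Q,P$ of degrees $L$ and $M$ respectively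 such that $P(x)\phi(x)-Q(x)$ vanishes at $b_1,\dots,b_{L+M+1}$, a repeated point being counted with multiplicity. When the points are $a_1,a_1,\dots,a_n,a_n$ and the type is $[n-1/n]$, the interpolation is a double one: $\phi(a_i)=(Q/P)(a_i)$ and $\phi'(a_i)=(Q/P)'(a_i)$ for $i=1,\dots,n$, equivalently $P(x)\phi(x)-Q(x)=r(x)\prod_{k=1}^n(x-a_k)^2$ with $r$ regular at all $a_k$ (the listed $2n$ double conditions being the ones imposed). *)

(* Defs.v *)
From HB Require Import structures.
From mathcomp Require Import all_boot all_order all_algebra.
From mathcomp Require Import fraction complex.
From mathcomp Require Import all_classical all_reals all_analysis.

Set Implicit Arguments.
Unset Strict Implicit.
Unset Printing Implicit Defensive.

Import Order.TTheory GRing.Theory Num.Theory.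
Import numFieldNormedType.Exports.

Local Open Scope classical_set_scope.
Local Open Scope ring_scope.

Notation "p %:F" := (@FracField.tofrac _ p) : ring_scope.

Section RationalFunctions.
Variable F : fieldType.

Definition ratfun := {fraction {poly F}}.

(* Lowest-terms numerator and denominator, up to a common nonzero scalar: the
   pair frac (repr f) is an arbitrary representative.                         *)
Definition ratnum (f : ratfun) : {poly F} :=
  let: (p, q) := frac (repr f) in p %/ gcdp p q.

Definition ratden (f : ratfun) : {poly F} :=
  let: (p, q) := frac (repr f) in q %/ gcdp p q.

(* Value after cancellation of common factors; the value at a pole is 0.      *)
Definition rateval (f : ratfun) (x : F) : F := (ratnum f).[x] / (ratden f).[x].

(* Composition f(g) in F(z); meaningful as soon as g is not a constant.       *)
Definition ratcomp (f g : ratfun) : ratfun :=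
  (map_poly (fun c : F => (c%:P)%:F) (ratnum f)).[g]
  / (map_poly (fun c : F => (c%:P)%:F) (ratden f)).[g].

Definition ratvar : ratfun := ('X : {poly F})%:F.

Definition joukowski : ratfun := (ratvar + ratvar^-1) / 2%:R.

(* c k stands for c_{k+1}.                                                    *)
Definition blaschke (c : nat -> F) (n : nat) : ratfun :=
  \prod_(k < n) (('X - (c k)%:P)%:F / (1 - (c k)%:P * 'X)%:F).

(* T and U are rational functions of x, characterized by what they become in
   F(z) under the substitution x = (z + 1/z)/2.                               *)
Definition is_chebT (c : nat -> F) (n : nat) (T : ratfun) : Prop :=
  ratcomp T joukowski = (blaschke c n + (blaschke c n)^-1) / 2%:R.

Definition is_chebU (c : nat -> F) (n : nat) (U : ratfun) : Prop :=
  ratcomp U joukowski =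
  (ratvar - ratvar^-1)^-1 * (blaschke c n.+1 - (blaschke c n.+1)^-1).

End RationalFunctions.

(* The norm topology of the field R[i] over itself, transferred from R[i]^o.   *)
HB.instance Definition _ (R : rcfType) := GRing.ComAlgebra.copy R[i] R[i]^o.
HB.instance Definition _ (R : rcfType) := Vector.copy R[i] R[i]^o.
HB.instance Definition _ (R : rcfType) := NormedModule.copy R[i] R[i]^o.

Section ComplexPlane.
Variable R : realType.
Local Notation C := R[i].

(* The order of R[i] compares only numbers with equal imaginary parts, so
   -1 <= x <= 1 says that x lies on the real segment [-1, 1].                 *)
Definition off_segment (x : C) : Prop := ~~ (-1 <= x <= 1).

(* Neighbourhoods of the point at infinity of the complex plane.              *)
Definition cinfty_nbhs : set_system C :=
  fun P => exists M : C, M \is Num.real /\ forall x, M < `|x| -> P x.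

Definition sqrt_branch (s : C -> C) : Prop :=
  [/\ forall x, off_segment x -> s x ^+ 2 = x ^+ 2 - 1,
      forall x, off_segment x -> derivable s x 1
    & s x / x @[x --> cinfty_nbhs] --> (1 : C)].

Definition regular_at (r : C -> C) (b : C) : Prop :=
  \forall x \near b, derivable r x 1.

(* g vanishes at the points of bs, a point being counted as many times as it
   occurs in the list.                                                        *)
Definition vanishes_at (g : C -> C) (bs : seq C) : Prop :=
  exists r : C -> C, forall b, b \in bs ->
    regular_at r b /\
    \forall x \near b, g x = r x * \prod_(b' <- bs) (x - b').

Definition multipoint_pade (L M : nat) (phi : C -> C) (bs : seq C)
    (f : ratfun C) : Prop :=
  size bs = (L + M).+1 /\
  exists Q P : {poly C},
    [/\ size Q = L.+1, size P = M.+1, f = Q%:F / P%:F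
      & vanishes_at (fun x => P.[x] * phi x - Q.[x]) bs].

End ComplexPlane.

(* Main.v *)
Require Import Defs.
From HB Require Import structures.
From mathcomp Require Import all_boot all_order all_algebra.
From mathcomp Require Import fraction complex.
From mathcomp Require Import all_classical all_reals all_analysis.
From mathcomp Require Import ring.

Set Implicit Arguments.
Unset Strict Implicit.
Unset Printing Implicit Defensive.

Import Order.TTheory GRing.Theory Num.Theory.
Import numFieldNormedType.Exports.

Local Open Scope classical_set_scope.
Local Open Scope ring_scope.

(** Write s for the branch of sqrt(x^2 - 1), phi = 1/s, and s_k = s(a_k), so that
    c_k = a_k - s_k.  Expanding in powers of s, where s^2 = x^2 - 1, gives
    polynomials A and B in x with
      A + B s = \prod_(k < n) (a_k x - 1 + s_k s),
      A - B s = \prod_(k < n) (a_k x - 1 - s_k s).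
    In the variable z, where x = (z + 1/z)/2 and s = (1/z - z)/2, the two factors
    of index k are (1 - c_k z)^2 and (z - c_k)^2, both divided by 2 c_k z
    (blaschke_factor).  Therefore f_n^2 = (A - B s)/(A + B s), and
      U_{n-1}/T_n = 2/(z - 1/z) * (f_n^2 - 1)/(f_n^2 + 1) = B/A
    (cheb_quotient; the passage from z back to x uses that the Joukowski
    substitution is injective on polynomials, polysubst_inj).

    The conjugate factors multiply to (a_k x - 1)^2 - (a_k^2 - 1)(x^2 - 1)
    = (x - a_k)^2.  Hence
      A phi - B = (A - B s)/s = \prod_(k < n) (x - a_k)^2 / (s (A + B s)),
    and the last denominator is regular and nonzero near each node
    (pade_error, conj_prod_neq0).  This is the double interpolation; equality of
    values and derivatives follows from double_contact.

    It remains to see that A and B have degrees exactly n and n - 1.  Their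
    leading coefficients are (C^-1 + C)/2 and (C^-1 - C)/2 with
    C = \prod_(k < n) c_k (pade_polys_exact_size), which are nonzero because
    |c_k| < 1.  That inequality is the only point where the behaviour of s at
    infinity enters: |x - s x| is never 1 off the segment, it is below 1 near
    infinity, and every point off the segment is joined to infinity by a ray
    (branch_norm_lt1). *)

(** * Derivatives over a numeric field *)

Section Derivability.
Variable K : numFieldType.
Implicit Types (f g h : K -> K) (x : K).

Lemma derivable_prod (I : Type) (r : seq I) (P : pred I) (f : I -> K -> K) x :
  (forall i, derivable (f i) x 1) ->
  derivable (fun y => \prod_(i <- r | P i) f i y) x 1.
Proof.
move=> df; elim: r => [|i r IHr].
  by under eq_fun do rewrite big_nil; exact: derivable_cst.
under eq_fun do rewrite big_cons.
case: (P i); last exact: IHr.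
exact: (derivableM (df i) IHr).
Qed.

Lemma derivable_poly_eval (p : {poly K}) x : derivable (fun y => p.[y]) x 1.
Proof.
elim/poly_ind: p => [|p c IHp].
  by under eq_fun do rewrite horner0; exact: derivable_cst.
under eq_fun do rewrite hornerMXaddC.
apply: derivableD; last exact: derivable_cst.
by apply: derivableM => //; exact: derivable_id.
Qed.

Lemma derivable_continuous f x : derivable f x 1 -> {for x, continuous f}.
Proof. by move/derivable1_diffP; exact: differentiable_continuous. Qed.

Lemma derivable_near_neq0 f x :
  derivable f x 1 -> f x != 0 -> \forall y \near x, f y != 0.
Proof. by move=> /derivable_continuous cf f0; exact: cvgr_neq0 cf f0. Qed.

Lemma derivable_norm_continuous f x :
  derivable f x 1 -> {for x, continuous (fun y => `|f y|)}.
Proof.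
move=> /derivable_continuous cf.
by apply: (continuous_comp cf); exact: norm_continuous.
Qed.

Lemma derivable_subl f x : derivable f x 1 -> derivable (fun y => y - f y) x 1.
Proof. by move=> df; exact: derivableB. Qed.

Lemma derivable_conj_prod (a b : nat -> K) f n x : derivable f x 1 ->
  derivable (fun y => \prod_(k < n) (a k * y - 1 + b k * f y)) x 1.
Proof.
move=> df; apply: derivable_prod => k.
apply: derivableD; last by apply: derivableM; [exact: derivable_cst|].
apply: derivableB; last exact: derivable_cst.
by apply: derivableM; [exact: derivable_cst|exact: derivable_id].
Qed.

Lemma derivable_invM f g x : f x != 0 -> g x != 0 ->
  derivable f x 1 -> derivable g x 1 -> derivable (fun y => (f y * g y)^-1) x 1.
Proof.
move=> f0 g0 df dg; apply: derivableV; first by rewrite mulf_neq0.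
exact: derivableM.
Qed.

Lemma derivable_horner_frac (p q : {poly K}) x :
  q.[x] != 0 -> derivable (fun y => p.[y] / q.[y]) x 1.
Proof.
move=> q0; apply: derivableM; first exact: derivable_poly_eval.
by apply: derivableV => //; exact: derivable_poly_eval.
Qed.

(** The shape of the error phi - B/A at a node once the squared factor of that
    node has been taken out; P selects the other nodes. *)
Lemma derivable_contact_rem f (b : nat -> K) n (P : pred 'I_n) (q : {poly K}) x :
  derivable f x 1 -> q.[x] != 0 ->
  derivable (fun y => f y * (\prod_(k < n | P k) (y - b k) ^+ 2) / q.[y]) x 1.
Proof.
move=> df q0; apply: derivableM; last first.
  by apply: derivableV => //; exact: derivable_poly_eval.
apply: (derivableM df); apply: derivable_prod => k.
have dk : derivable (fun y => y - b k) x 1.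
  by apply: derivableB; [exact: derivable_id|exact: derivable_cst].
exact: (derivableM dk dk).
Qed.

(** Functions whose difference is a multiple of (y - x)^2 agree to first order:
    the product rule makes the correction vanish together with its
    derivative. *)
Lemma double_contact f g h x :
  derivable g x 1 -> derivable h x 1 ->
  (\forall y \near x, f y = g y + h y * (y - x) ^+ 2) ->
  [/\ derivable f x 1, f x = g x & derive1 f x = derive1 g x].
Proof.
move=> dg dh fE.
have did : is_derive x 1 (fun y : K => y - x) 1.
  by rewrite -[X in is_derive _ _ _ X]subr0; apply: is_deriveB.
have dg' := derivableP dg; have dh' := derivableP dh.
have D : is_derive x 1 (fun y => g y + h y * ((y - x) * (y - x))) ('D_1 g x).
  apply: is_derive_eq (is_deriveD dg' (is_deriveM dh' (is_deriveM did did))) _.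
  have -> : ((fun y => y - x) * (fun y => y - x)) x = (x - x) * (x - x) by [].
  by rewrite !subrr scale0r !addr0 mulr0 !scaler0 scale0r !addr0.
have D' : is_derive x 1 f ('D_1 g x).
  apply: near_eq_is_derive D; apply: filterS fE => y ->.
  by rewrite expr2.
split; first exact: ex_derive.
  by rewrite (nbhs_singleton fE) subrr expr0n mulr0 addr0.
by rewrite !derive1E; apply: derive_val.
Qed.

End Derivability.

Lemma prod_norm_lt1 (K : numDomainType) (c : nat -> K) (n : nat) :
  (forall k, `|c k| < 1) -> `|\prod_(k < n.+1) c k| < 1.
Proof.
move=> c1; rewrite big_ord_recl normrM.
apply: le_lt_trans (c1 0%N); apply: ler_piMr => //.
rewrite normr_prod; apply: prodr_ile1 => k _; rewrite normr_ge0.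
exact: ltW.
Qed.

Lemma sqr_neq_unit (K : numDomainType) (x y : K) :
  `|x| < 1 -> `|y| = 1 -> x ^+ 2 != y.
Proof.
move=> x1 y1; apply/eqP => xy.
suff: `|x| ^+ 2 < 1 by rewrite -normrX xy y1 ltxx.
by rewrite expr_lt1.
Qed.

(** * The polynomials A and B *)

(** The pair (A, B) determined by
    A + B sqrt('X^2 - 1) = \prod_(k < n) (a k 'X - 1 + s k sqrt('X^2 - 1)),
    computed without adjoining the square root.  With s k = sqrt(a k ^ 2 - 1)
    these are the Pade denominator and numerator. *)
Fixpoint pade_polys (F : nzRingType) (a s : nat -> F) (n : nat) :
    {poly F} * {poly F} :=
  if n is m.+1 then
    let: (A, B) := pade_polys a s m in
    let l := a m *: 'X - 1 in
    (l * A + s m *: (('X^2 - 1) * B), l * B + s m *: A)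
  else (1, 0).

(** Any S with S^2 = 'X^2 - 1 after a specialization phi may play the part of
    the square root.  This is applied to numbers x, with S = s x or - s x, and
    to the Joukowski substitution, where the square root is rational. *)
Lemma pade_polys_morph (F K : comNzRingType) (phi : {rmorphism {poly F} -> K})
    (a s : nat -> F) (S : K) (n : nat) :
  S ^+ 2 = phi 'X ^+ 2 - 1 ->
  phi (pade_polys a s n).1 + phi (pade_polys a s n).2 * S =
  \prod_(k < n) (phi (a k)%:P * phi 'X - 1 + phi (s k)%:P * S).
Proof.
move=> S2; elim: n => [|n IHn] /=.
  by rewrite big_ord0 rmorph1 rmorph0; ring.
rewrite big_ord_recr /= -{}IHn; case: (pade_polys a s n) => A B /=.
have -> : ('X^2 - 1 : {poly F}) = 'X * 'X - 1 by [].
rewrite -!mul_polyC !(rmorphD, rmorphN, rmorphM, rmorph1) /= -expr2 -S2.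
ring.
Qed.

Lemma pade_polys_oppr (F : comNzRingType) (a s : nat -> F) (n : nat) :
  pade_polys a (fun k => - s k) n =
  ((pade_polys a s n).1, - (pade_polys a s n).2).
Proof.
elim: n => [|n IHn] /=; first by rewrite oppr0.
rewrite {}IHn; case: (pade_polys a s n) => A B /=.
by rewrite -!mul_polyC !polyCN; congr pair; ring.
Qed.

(** Since sqrt(x^2 - 1) ~ x at infinity, the leading coefficients of A and B add
    up to that of the product of the a k x - 1 + s k x.  The coefficient of B is
    read on 'X * B so that n = 0 needs no separate treatment. *)
Lemma pade_polys_coef (F : comNzRingType) (a s : nat -> F) (n : nat) :
  [/\ forall j, (n < j)%N -> (pade_polys a s n).1`_j = 0,
      forall j, (n <= j)%N -> (pade_polys a s n).2`_j = 0
    & (pade_polys a s n).1`_n + ('X * (pade_polys a s n).2)`_n =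
      \prod_(k < n) (a k + s k)].
Proof.
elim: n => [|n] /=.
  split=> [[|j]// _|j _|]; rewrite ?coef1 ?coef0 ?mulr0 ?coef0 ?addr0 //.
  by rewrite big_ord0.
rewrite big_ord_recr /=.
case: (pade_polys a s n) => A B /= [A0 B0 <-].
have linM (p : {poly F}) j :
    ((a n *: 'X - 1) * p)`_j.+1 = a n * p`_j - p`_j.+1.
  by rewrite mulrBl mul1r -scalerAl coefB coefZ coefXM.
have quadM (p : {poly F}) j :
    (('X^2 - 1) * p)`_j.+1 = ('X * p)`_j - p`_j.+1.
  by rewrite mulrBl mul1r coefB coefXnM coefXM subn2; case: j.
split=> [[|j]// nj|[|j]// nj|]; rewrite ?(coefD, coefZ, linM, quadM).
- rewrite coefXM; case: j nj => //= j; rewrite !ltnS => nj.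
  by rewrite !A0 ?B0 ?ltnS// ?leqW// ?leqW//; ring.
- by move: nj; rewrite ltnS => nj; rewrite !B0 ?A0 ?ltnS// ?leqW//; ring.
rewrite [X in _ + X]coefXM/= coefD coefZ (A0 n.+1)// (B0 n.+1)//.
have -> : ((a n *: 'X - 1) * B)`_n = a n * ('X * B)`_n.
  case: n A0 B0 linM {quadM} => [|n] A0 B0 linM.
    by rewrite mulrBl mul1r -scalerAl coefB coefZ !coefXM/= B0// subr0.
  by rewrite linM coefXM/= (B0 n.+1)// subr0.
ring.
Qed.

(** Write C for the product of the c k.  The two conjugate choices of the square
    root say that the leading coefficients of A and B have sum C^-1 and
    difference C; so they are (C^-1 + C)/2 and (C^-1 - C)/2. *)
Lemma pade_polys_exact_size (F : fieldType) (a s c : nat -> F) (n : nat) :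
  (forall k, c k = a k - s k) -> (forall k, c k * (a k + s k) = 1) ->
  (\prod_(k < n) c k) ^+ 2 != -1 -> (\prod_(k < n) c k) ^+ 2 != 1 ->
  size (pade_polys a s n).1 = n.+1 /\ size (pade_polys a s n).2 = n.
Proof.
move=> cE cV c2N1 c21.
have [A0 B0 sumE] := pade_polys_coef a s n.
(* The conjugate pair gives the difference of the leading coefficients. *)
have [_ _] := pade_polys_coef a (fun k => - s k) n.
rewrite pade_polys_oppr /= mulrN coefN.
set C := \prod_(k < n) c k in c2N1 c21 *.
have -> : \prod_(k < n) (a k - s k) = C.
  by apply: eq_bigr => k _; rewrite cE.
have : C * \prod_(k < n) (a k + s k) = 1.
  by rewrite -big_split /=; apply: big1 => k _; rewrite cV.
rewrite -{}sumE; set x := _`_n; set y := _`_n => CV CE.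
have x0 : x != 0.
  apply: contra c2N1 => /eqP x0; move: CV CE.
  by rewrite x0 sub0r add0r => CV CE; rewrite -CV -CE; apply/eqP; ring.
have y0 : y != 0.
  apply: contra c21 => /eqP y0; move: CV CE.
  by rewrite y0 subr0 addr0 => CV CE; rewrite -CV CE.
have sizeE (p : {poly F}) m :
    (forall j, (m < j)%N -> p`_j = 0) -> p`_m != 0 -> size p = m.+1.
  move=> p0 pm; apply/eqP; rewrite eqn_leq; apply/andP; split.
    by apply/leq_sizeP => j /p0.
  by rewrite ltnNge; apply: contra pm => /leq_sizeP ->.
split; first exact: sizeE.
move: y0; rewrite /y coefXM.
case: n B0 {A0 x0 CV CE x y c2N1 c21 C} => [|n] B0 /=; first by rewrite eqxx.
exact: sizeE.
Qed.

(** * Rational functions and substitution *)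

Section RatfunSubstitution.
Variable F : fieldType.
Implicit Types (f g : ratfun F) (p q : {poly F}).

Lemma ratfun_repr f : f = (frac (repr f)).1%:F / (frac (repr f)).2%:F.
Proof.
have d0 : (frac (repr f)).2 != 0 by exact: denom_ratioP.
apply: (mulIf (x := (frac (repr f)).2%:F)); first by rewrite tofrac_eq0.
rewrite divfK ?tofrac_eq0//.
rewrite -{1}[f]reprK; move: (repr f) d0 => x d0.
rewrite !piE; apply/eqP; rewrite piE /FracField.equivf /FracField.mulf.
by rewrite !numden_Ratio ?mulr1 ?oner_neq0// mulrC.
Qed.

Lemma ratden_neq0 f : ratden f != 0.
Proof.
rewrite /ratden; have := denom_ratioP (repr f).
case: (frac (repr f)) => p q /= q0.
by rewrite dvdp_div_eq0 ?dvdp_gcdr.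
Qed.

Lemma ratfunE f : f = (ratnum f)%:F / (ratden f)%:F.
Proof.
rewrite {1}[f]ratfun_repr /ratnum /ratden; have := denom_ratioP (repr f).
case: (frac (repr f)) => p q /= q0.
have g0 : gcdp p q != 0 by rewrite gcdp_eq0 negb_and q0 orbT.
have := divpK (dvdp_gcdl p q); have := divpK (dvdp_gcdr p q).
move: (gcdp p q) g0 => g g0 qE pE; rewrite -{1}pE -{1}qE !tofracM.
by rewrite -mulf_div divff ?mulr1 ?tofrac_eq0.
Qed.

(** The lowest-terms denominator divides q, so it does not vanish at x either. *)
Lemma rateval_frac p q x : q.[x] != 0 -> rateval (p%:F / q%:F) x = p.[x] / q.[x].
Proof.
move=> qx0; rewrite /rateval.
have q0 : q != 0 by apply: contraNneq qx0 => ->; rewrite horner0.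
have fE := ratfunE (p%:F / q%:F); move: fE.
set f := p%:F / q%:F => fE.
have cop : coprimep (ratnum f) (ratden f).
  rewrite /ratnum /ratden; have := denom_ratioP (repr f).
  case: (frac (repr f)) => u v /= v0.
  by rewrite coprimep_div_gcd // v0 orbT.
have E : p * ratden f = ratnum f * q.
  apply/eqP; rewrite -tofrac_eq !tofracM; apply/eqP.
  have := fE; rewrite /f => /eqP; rewrite eqr_div ?tofrac_eq0 ?ratden_neq0//.
  by move=> /eqP.
have dvd : ratden f %| q.
  have cop' : coprimep (ratden f) (ratnum f) by rewrite coprimep_sym.
  by rewrite -(Gauss_dvdpr q cop') -E dvdp_mull.
have d0 : (ratden f).[x] != 0.
  apply: contra qx0 => dx; move/dvdpP: dvd => [u ->].
  by rewrite hornerM (eqP dx) mulr0.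
by apply/eqP; rewrite eqr_div// -!hornerM E.
Qed.

(** Numerator and denominator of ratcomp are values of this map; naming it lets
    it be declared a ring morphism. *)
Definition polysubst (g : ratfun F) (p : {poly F}) : ratfun F :=
  (map_poly (fun c : F => (c%:P)%:F) p).[g].

Lemma polysubst_is_zmod_morphism g : zmod_morphism (polysubst g).
Proof.
move=> p q; rewrite /polysubst -hornerN -hornerD; congr (_.[_]).
exact: (rmorphB (map_poly (@FracField.tofrac {poly F} \o @polyC F))).
Qed.

Lemma polysubst_is_monoid_morphism g : monoid_morphism (polysubst g).
Proof.
split=> [|p q]; rewrite /polysubst.
  have -> : map_poly (fun c : F => (c%:P)%:F) 1 = 1 :> {poly ratfun F}.
    exact: (rmorph1 (map_poly (@FracField.tofrac {poly F} \o @polyC F))).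
  by rewrite hornerC.
rewrite -hornerM; congr (_.[_]).
exact: (rmorphM (map_poly (@FracField.tofrac {poly F} \o @polyC F))).
Qed.

HB.instance Definition _ g := GRing.isZmodMorphism.Build _ _ (polysubst g)
  (polysubst_is_zmod_morphism g).
HB.instance Definition _ g := GRing.isMonoidMorphism.Build _ _ (polysubst g)
  (polysubst_is_monoid_morphism g).

Lemma polysubstC g c : polysubst g c%:P = (c%:P)%:F.
Proof.
rewrite /polysubst.
have -> : map_poly (fun c : F => (c%:P)%:F) c%:P = ((c%:P)%:F)%:P.
  exact: (map_polyC (@FracField.tofrac {poly F} \o @polyC F)).
by rewrite hornerC.
Qed.

Lemma polysubstX g : polysubst g 'X = g.
Proof.
rewrite /polysubst.
have -> : map_poly (fun c : F => (c%:P)%:F) 'X = 'X.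
  exact: (map_polyX (@FracField.tofrac {poly F} \o @polyC F)).
by rewrite hornerX.
Qed.

End RatfunSubstitution.

(** A polynomial that vanishes at g splits into linear factors, one of which
    must then vanish at g, making g a constant. *)
Lemma polysubst_inj (F : closedFieldType) (g : ratfun F) :
  (forall c : F, g != (c%:P)%:F) -> injective (polysubst g).
Proof.
move=> gNc; apply: raddf_inj => p /eqP.
have [r ->] := closed_field_poly_normal p.
rewrite -mul_polyC /= rmorphM rmorph_prod mulf_eq0 /= => /orP[|].
  by rewrite polysubstC tofrac_eq0 polyC_eq0 => /eqP ->; rewrite polyC0 mul0r.
rewrite prodf_seq_eq0 => /hasP[c _] /=.
by rewrite rmorphB /= polysubstC polysubstX subr_eq0 (negPf (gNc c)).
Qed.

(** * The quotient of the Chebyshev rational functions *)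

(** Identities that involve inverses are proved in an abstract field and only
    then instantiated at rational functions. *)
Lemma joukowski_clear (K : fieldType) (w : K) :
  w != 0 -> 2%:R != 0 :> K -> 2%:R * w * ((w + w^-1) / 2%:R) = w ^+ 2 + 1.
Proof. by move=> w0 two0; field; rewrite w0 two0. Qed.

Lemma ratvar_neq0 (F : fieldType) : ratvar F != 0.
Proof. by rewrite /ratvar tofrac_eq0 polyX_eq0. Qed.

Lemma ratfun_two_neq0 (F : fieldType) : 2%:R != 0 :> F -> 2%:R != 0 :> ratfun F.
Proof.
move=> two0; rewrite -(rmorph_nat (@FracField.tofrac {poly F})) tofrac_eq0.
by rewrite -(rmorph_nat (@polyC F)) polyC_eq0.
Qed.

Lemma joukowski_neqC (F : fieldType) (c : F) :
  2%:R != 0 :> F -> joukowski F != (c%:P)%:F.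
Proof.
(* Clearing denominators, 'X^2 + 1 would equal 2 c 'X. *)
move=> two0; apply/eqP => /(congr1 (fun g => 2%:R * ratvar F * g)).
rewrite /joukowski joukowski_clear ?ratvar_neq0 ?ratfun_two_neq0//.
have -> : 2%:R * ratvar F * (c%:P)%:F = ((2%:R * 'X) * c%:P)%:F.
  by rewrite !rmorphM /= rmorph_nat.
have -> : ratvar F ^+ 2 + 1 = ('X^2 + 1)%:F by rewrite rmorphD rmorphXn rmorph1.
move/eqP; rewrite tofrac_eq => /eqP /(congr1 (fun p : {poly F} => p`_2)).
rewrite coefD coefXn coef1 coefMC mulr_natl coefMn coefX /= mul0rn mul0r addr0.
by move/eqP; rewrite oner_eq0.
Qed.

(** With x = (w + w^-1)/2 and S = (w^-1 - w)/2, a square root of x^2 - 1, and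
    with a = (c + c^-1)/2, one has
    (w - c)^2 = 2 c w (a x - 1 - s S) and (1 - c w)^2 = 2 c w (a x - 1 + s S):
    each squared Blaschke factor is a quotient of two conjugates. *)
Lemma blaschke_factor (K : fieldType) (w a s c : K) :
  w != 0 -> 2%:R != 0 :> K -> c = a - s -> s ^+ 2 = a ^+ 2 - 1 ->
  let j := (w + w^-1) / 2%:R in let S := (w^-1 - w) / 2%:R in
  (w - c) ^+ 2 * (a * j - 1 + s * S) = (1 - c * w) ^+ 2 * (a * j - 1 - s * S).
Proof.
move=> w0 two0 -> s2 j S.
have a2 : a ^+ 2 = s ^+ 2 + 1 by rewrite s2 subrK.
apply: (mulfI w0); apply: (mulfI two0).
have -> : 2%:R * (w * ((w - (a - s)) ^+ 2 * (a * j - 1 + s * S))) =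
  (w - (a - s)) ^+ 2 * (a * (w ^+ 2 + 1) - 2%:R * w + s * (1 - w ^+ 2)).
  by rewrite /j /S; field; rewrite w0 two0.
have -> : 2%:R * (w * ((1 - (a - s) * w) ^+ 2 * (a * j - 1 - s * S))) =
  (1 - (a - s) * w) ^+ 2 * (a * (w ^+ 2 + 1) - 2%:R * w - s * (1 - w ^+ 2)).
  by rewrite /j /S; field; rewrite w0 two0.
ring: a2.
Qed.

(** The hypothesis reads f^2 = (A - B S)/(A + B S), hence
    (f^2 - 1)/(f^2 + 1) = - S B/A, and w - w^-1 = - 2 S. *)
Lemma cheb_cross (K : fieldType) (w f A B : K) :
  let S := (w^-1 - w) / 2%:R in
  2%:R != 0 :> K -> f != 0 -> w - w^-1 != 0 ->
  f ^+ 2 * (A + B * S) = A - B * S ->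
  (w - w^-1)^-1 * (f - f^-1) * A = (f + f^-1) / 2%:R * B.
Proof.
move=> S two0 f0 d0 fE.
have SE : S = - ((w - w^-1) / 2%:R) by rewrite /S -mulNr opprB.
move: (w - w^-1) d0 SE => d d0 SE; rewrite {}SE in fE.
apply: (mulfI d0); apply: (mulfI f0); apply: (mulfI two0).
have -> : 2%:R * (f * (d * (d^-1 * (f - f^-1) * A))) = 2%:R * (f ^+ 2 * A - A).
  by field; rewrite d0 f0.
have -> : 2%:R * (f * (d * ((f + f^-1) / 2%:R * B))) = d * (f ^+ 2 + 1) * B.
  by field; rewrite two0 f0.
have fA : f ^+ 2 * A = A + B * (d / 2%:R) + f ^+ 2 * (B * (d / 2%:R)).
  by move: fE; rewrite mulrN opprK => <-; ring.
by rewrite fA; field.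
Qed.

Lemma blaschke_den_neq0 (F : fieldType) (c : F) :
  (1 - c%:P * 'X)%:F != 0 :> ratfun F.
Proof.
rewrite tofrac_eq0; apply/eqP => /(congr1 (fun p : {poly F} => p`_0)).
by rewrite coefB coefMX coef1 coef0 subr0 => /eqP; rewrite oner_eq0.
Qed.

Lemma joukowski_sqrt (K : fieldType) (w : K) :
  w != 0 -> 2%:R != 0 :> K ->
  ((w^-1 - w) / 2%:R) ^+ 2 = ((w + w^-1) / 2%:R) ^+ 2 - 1.
Proof. by move=> w0 two0; field; rewrite w0 two0. Qed.

(** The square of the Blaschke product is the quotient of the conjugates
    A - B sqrt(x^2 - 1) and A + B sqrt(x^2 - 1), rewritten in the variable z. *)
Lemma blaschke_sqr (F : fieldType) (a s c : nat -> F) (n : nat) :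
  2%:R != 0 :> F ->
  (forall k, c k = a k - s k) -> (forall k, s k ^+ 2 = a k ^+ 2 - 1) ->
  let A := polysubst (joukowski F) (pade_polys a s n).1 in
  let B := polysubst (joukowski F) (pade_polys a s n).2 in
  let S := ((ratvar F)^-1 - ratvar F) / 2%:R in
  blaschke c n ^+ 2 * (A + B * S) = A - B * S.
Proof.
move=> two0 cE s2 A B S.
have two0' := ratfun_two_neq0 two0.
have S2 : S ^+ 2 = polysubst (joukowski F) 'X ^+ 2 - 1.
  by rewrite polysubstX; apply: joukowski_sqrt; rewrite ?ratvar_neq0.
rewrite /A /B pade_polys_morph//.
have -> : polysubst (joukowski F) (pade_polys a s n).1 -
    polysubst (joukowski F) (pade_polys a s n).2 * S =
  \prod_(k < n) ((a k)%:P%:F * joukowski F - 1 - (s k)%:P%:F * S).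
  rewrite -mulrN pade_polys_morph ?sqrrN//; apply: eq_bigr => k _.
  by rewrite /= !polysubstC polysubstX mulrN.
rewrite /blaschke -prodrXl -big_split /=; apply: eq_bigr => k _.
rewrite /= !polysubstC polysubstX.
have d0 : (1 - (c k)%:P * 'X)%:F != 0 :> ratfun F.
  exact: blaschke_den_neq0.
rewrite expr_div_n mulrAC; apply: (mulIf (expf_neq0 2 d0)).
rewrite divfK ?expf_neq0// [RHS]mulrC.
rewrite !tofracB !tofracM tofrac1.
have cE' : (c k)%:P%:F = (a k)%:P%:F - (s k)%:P%:F :> ratfun F.
  by rewrite cE polyCB tofracB.
have s2' : (s k)%:P%:F ^+ 2 = (a k)%:P%:F ^+ 2 - 1 :> ratfun F.
  by rewrite -tofracXn -polyC_exp s2 polyCB tofracB polyC_exp tofracXn.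
have := blaschke_factor (ratvar_neq0 F) two0' cE' s2'.
move=> /= E; rewrite -/(ratvar F) -/(joukowski F) -/S in E *.
exact: E.
Qed.

Lemma sqr_of_addV_eq0 (K : fieldType) (f : K) :
  f != 0 -> 2%:R != 0 :> K -> (f + f^-1) / 2%:R = 0 -> f ^+ 2 = -1.
Proof.
move=> f0 two0 /eqP; rewrite mulf_eq0 invr_eq0 (negPf two0) orbF addr_eq0.
by move=> /eqP fE; rewrite expr2 {2}fE mulrN divff.
Qed.

Lemma cross_multiply (K : fieldType) (x y z w A B : K) :
  y != 0 -> w != 0 -> x / y * A = z / w * B -> x * w * A = z * y * B.
Proof.
move=> y0 w0 E; have : x / y * A * (y * w) = z / w * B * (y * w) by rewrite E.
have -> : x / y * A * (y * w) = x * w * A by field.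
by move=> ->; field.
Qed.

Lemma quotient_eq (K : fieldType) (x y z w A B : K) :
  y != 0 -> w != 0 -> z != 0 -> A != 0 ->
  x * w * A = z * y * B -> x / y / (z / w) = B / A.
Proof.
move=> y0 w0 z0 A0 E; have -> : B = x * w * A / (z * y).
  by rewrite E; field; rewrite z0 y0.
by field; rewrite y0 w0 z0 A0.
Qed.

(** After the substitution the claim is lemma cheb_cross; injectivity of the
    substitution brings it back to rational functions of x. *)
Lemma cheb_quotient (F : closedFieldType) (a s c : nat -> F) (n : nat)
    (T U : ratfun F) :
  2%:R != 0 :> F ->
  (forall k, c k = a k - s k) -> (forall k, s k ^+ 2 = a k ^+ 2 - 1) ->
  (pade_polys a s n.+1).1 != 0 ->
  is_chebT c n.+1 T -> is_chebU c n U ->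
  U / T = (pade_polys a s n.+1).2%:F / (pade_polys a s n.+1).1%:F.
Proof.
move=> two0 cE s2 A0 TE UE.
have two0' := ratfun_two_neq0 two0.
set A := (pade_polys a s n.+1).1 in A0 *; set B := (pade_polys a s n.+1).2.
have phi_inj : injective (polysubst (joukowski F)).
  by apply: polysubst_inj => x; apply: joukowski_neqC.
have phi0 p : (polysubst (joukowski F) p == 0) = (p == 0).
  apply/eqP/eqP => [|->]; rewrite ?rmorph0// => H.
  by apply: phi_inj; rewrite rmorph0.
move: TE UE; rewrite /is_chebT /is_chebU /ratcomp -!/(polysubst _ _).
set f := blaschke c n.+1 => TE UE.
have w1 : ratvar F - (ratvar F)^-1 != 0.
  apply/eqP => /(congr1 (fun g => ratvar F * g)).
  rewrite mulrBr mulr0 divff ?ratvar_neq0// => /eqP.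
  rewrite /ratvar -tofracM -tofrac1 -tofracB tofrac_eq0 => /eqP.
  move=> /(congr1 (fun p : {poly F} => p`_2)).
  by rewrite -expr2 coefB coefXn coef1 coef0 subr0 => /eqP; rewrite oner_eq0.
have f0 : f != 0.
  apply/prodf_neq0 => k _.
  apply: mulf_neq0; first by rewrite tofrac_eq0 polyXsubC_eq0.
  rewrite invr_eq0; exact: blaschke_den_neq0.
have := cheb_cross two0' f0 w1 (blaschke_sqr n.+1 two0 cE s2).
have -> : T = (ratnum T)%:F / (ratden T)%:F by exact: ratfunE.
have -> : U = (ratnum U)%:F / (ratden U)%:F by exact: ratfunE.
have dT0 : polysubst (joukowski F) (ratden T) != 0 by rewrite phi0 ratden_neq0.
have dU0 : polysubst (joukowski F) (ratden U) != 0 by rewrite phi0 ratden_neq0.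
(* T = 0 would give f^2 = -1, and blaschke_sqr would then give 2 A = 0. *)
have T0 : ratnum T != 0.
  rewrite -phi0; apply/eqP => nT0.
  have fN : f ^+ 2 = -1.
    by apply: (sqr_of_addV_eq0 f0 two0'); rewrite -TE nT0 mul0r.
  have := blaschke_sqr n.+1 two0 cE s2; rewrite /= -/f -/A -/B fN mulN1r opprD.
  move/eqP; rewrite (inj_eq (addIr _)) eq_sym -addr_eq0 -mulr2n -mulr_natl.
  rewrite mulf_eq0.
  by rewrite (negPf two0') phi0 (negPf A0).
rewrite -{}TE -{}UE => cross.
have E : ratnum U * ratden T * A = ratnum T * ratden U * B.
  by apply: phi_inj; rewrite !rmorphM; exact: (cross_multiply dU0 dT0 cross).
have frac0 p : p != 0 -> p%:F != 0 :> ratfun F by rewrite tofrac_eq0.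
apply: quotient_eq; [exact: frac0 (ratden_neq0 U)|exact: frac0 (ratden_neq0 T)|
  exact: frac0 T0|exact: frac0 A0|].
by rewrite -!tofracM E.
Qed.

(** * The branch of the square root *)

Section ComplexTopology.
Variable R : realType.
Local Notation C := R[i].
Local Open Scope complex_scope.

Lemma Re_continuous : continuous (@complex.Re R : C -> R).
Proof.
move=> x; apply/(@cvgrPdist_lt _ _ _ (nbhs x)) => e e0.
have H : \forall y \near x, ball x e%:C y by apply: nbhsx_ballx; rewrite ltcR.
apply: filterS H => y; rewrite -ball_normE /ball_/= => xy.
by rewrite -raddfB -ltcR; apply: le_lt_trans xy; exact: normc_ge_Re.
Qed.

Lemma Im_continuous : continuous (@complex.Im R : C -> R).
Proof.
move=> x; apply/(@cvgrPdist_lt _ _ _ (nbhs x)) => e e0.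
have H : \forall y \near x, ball x e%:C y by apply: nbhsx_ballx; rewrite ltcR.
apply: filterS H => y; rewrite -ball_normE /ball_/= => xy.
rewrite -raddfB -normrN -ReiNIm -ltcR; apply: le_lt_trans xy.
apply: le_trans (normc_ge_Re _) _.
have i1 : `|'i%C : C| = 1 by rewrite normc_def/= expr0n expr1n add0r sqrtr1.
by rewrite normrM i1 mulr1.
Qed.

Lemma real_complex_continuous : continuous (real_complex R : R -> C).
Proof.
move=> x; apply/(@cvgrPdist_lt _ _ _ (nbhs x)) => e e0.
have eR : (complex.Re e)%:C = e by rewrite RRe_real ?gtr0_real.
have H : \forall y \near x, ball x (complex.Re e) y.
  by apply: nbhsx_ballx; rewrite -ltcR eR.
apply: filterS H => y; rewrite -ball_normE /ball_/= => xy.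
rewrite -rmorphB normc_def/= expr0n addr0 sqrtr_sqr.
by rewrite -eR ltcR.
Qed.

Lemma off_segmentE (x : C) : off_segment x <->
  [\/ complex.Im x != 0, complex.Re x < -1 | 1 < complex.Re x].
Proof.
rewrite /off_segment !lecE/= oppr0 [0 == _]eq_sym !negb_and -!ltNge; split.
  by move=> /orP[/orP[]|/orP[]] ?; by [apply: Or31|apply: Or32|apply: Or33].
by case=> ->; rewrite ?orbT.
Qed.

Lemma off_segment_near (x : C) : off_segment x -> \forall y \near x, off_segment y.
Proof.
move=> /off_segmentE[x0|x1|x1].
- apply: filterS (cvgr_neq0 _ (@Im_continuous x) x0) => y y0.
  by apply/off_segmentE/Or31.
- apply: filterS (cvgr_lt _ (@Re_continuous x) _ x1) => y y0.
  by apply/off_segmentE/Or32.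
- apply: filterS (cvgr_gt _ (@Re_continuous x) _ x1) => y y0.
  by apply/off_segmentE/Or33.
Qed.

Lemma off_segmentZ (t x : C) : 1 <= t -> off_segment x -> off_segment (t * x).
Proof.
move=> t1; apply: contra => /andP[lo up].
have t0 : 0 < t by apply: lt_le_trans t1.
apply/andP; split; rewrite -(ler_pM2l t0) ?mulrN mulr1 ?(le_trans up t1)//.
by apply: le_trans lo; rewrite lerN2.
Qed.

Lemma off_segment_neq0 (x : C) : off_segment x -> x != 0.
Proof.
by move=> xo; apply/eqP => x0; move: xo; rewrite /off_segment x0 lerN10 ler01.
Qed.

(** On the unit circle the inverse is the conjugate, so x = Re z. *)
Lemma unit_circle_segment (z w x : C) :
  z * w = 1 -> `|z| = 1 -> z + w = x *+ 2 -> -1 <= x <= 1.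
Proof.
move=> zw z1 zx.
have z0 : z != 0 by rewrite -normr_eq0 z1 oner_neq0.
have wE : w = z^*.
  by rewrite -[w]mul1r -(mulVf z0) -mulrA zw mulr1 invc_norm z1 expr1n invr1 mul1r.
have -> : x = (complex.Re z)%:C.
  move: zx; rewrite wE addcJ mulr_natl => /eqP; rewrite eqrMn2r//= => /eqP //.
rewrite -(rmorph1 (real_complex R)) -rmorphN !lecR -ler_norml -lecR.
by apply: le_trans (normc_ge_Re _) _; rewrite z1.
Qed.

Section Branch.
Variable s : C -> C.
Hypothesis s_branch : sqrt_branch s.

Lemma branch_sqr x : off_segment x -> s x ^+ 2 = x ^+ 2 - 1.
Proof. by case: s_branch => + _ _; apply. Qed.

Lemma branch_derivable x : off_segment x -> derivable s x 1.
Proof. by case: s_branch => _ + _; apply. Qed.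

Lemma branch_neq0 x : off_segment x -> s x != 0.
Proof.
move=> xo; apply/eqP => sx0; have := branch_sqr xo.
have N11 : -1 <= 1 :> C by rewrite (@le_trans _ _ 0) ?lerN10.
rewrite sx0 expr0n/= => /esym/eqP; rewrite subr_eq0 sqrf_eq1 => /orP[] /eqP x1.
  by move: xo; rewrite /off_segment x1 lexx N11.
by move: xo; rewrite /off_segment x1 lexx N11.
Qed.

Lemma branch_mul x : off_segment x -> (x - s x) * (x + s x) = 1.
Proof. by move=> xo; rewrite -subr_sqr (branch_sqr xo) opprB addrC subrK. Qed.

Lemma branch_norm_neq1 x : off_segment x -> `|x - s x| != 1.
Proof.
move=> xo; apply/eqP => z1; move/negP: (xo); apply.
by apply: (unit_circle_segment (branch_mul xo) z1); rewrite addrACA addNr addr0.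
Qed.

(** The normalization s x ~ x is what selects the root of modulus below 1: it
    makes |x - s x| < |x|, while |x - s x| >= 1 would force |x + s x| <= 1 and
    hence 2 |x| <= 2 |x - s x|. *)
Lemma branch_infty_lt1 : exists M : C, M \is Num.real /\
  forall x, off_segment x -> M < `|x| -> `|x - s x| < 1.
Proof.
case: s_branch => _ _ s_infty.
have [M [Mr HM]] := s_infty _ (nbhsx_ballx (1 : C) 1 ltr01).
exists M; split=> // x xo /HM; rewrite -ball_normE /ball_/= => x1.
have x0 := off_segment_neq0 xo.
rewrite real_ltNge ?normr_real ?real1//; apply/negP => u1.
have v1 : `|x + s x| <= 1.
  rewrite -(ler_pM2l (lt_le_trans ltr01 u1)) -normrM branch_mul// normr1 mulr1.
  by [].
have : `|x - s x| < `|x|.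
  rewrite -[X in _ < X]mul1r -ltr_pdivrMr ?normr_gt0// -normf_div.
  by rewrite mulrBl divff.
rewrite real_ltNge ?normr_real//; move/negP; apply.
rewrite -(ler_pMn2r (n := 2))// -normrMn.
have -> : x *+ 2 = (x - s x) + (x + s x) by rewrite addrACA addNr addr0.
rewrite mulr2n (le_trans (ler_normD _ _))// lerD2l.
exact: le_trans u1.
Qed.

Lemma branch_norm_continuous x : off_segment x ->
  {for x, continuous (fun y => complex.Re `|y - s y|)}.
Proof.
move=> /branch_derivable ds.
have cn := derivable_norm_continuous (derivable_subl ds).
by apply: (continuous_comp cn); exact: Re_continuous.
Qed.

(** Along the ray t x, t >= 1, which stays off the segment and goes to infinity,
    |t x - s (t x)| is continuous and never 1; it is below 1 far out, hence
    everywhere. *)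
Lemma branch_norm_lt1 x : off_segment x -> `|x - s x| < 1.
Proof.
move=> xo.
have [M [Mr HM]] := branch_infty_lt1.
have x0 := off_segment_neq0 xo.
(* A parameter for which |t0 x| = |x| + |M| > M. *)
pose t0 : R := complex.Re (1 + `|M| / `|x|).
have t0E : t0%:C = 1 + `|M| / `|x|.
  by rewrite RRe_real// realD ?real1// ger0_real// divr_ge0.
have t01 : 1 <= t0 by rewrite -lecR t0E lerDl divr_ge0.
pose f (t : R) : R := complex.Re `|t%:C * x - s (t%:C * x)|.
have fE t : (f t)%:C = `|t%:C * x - s (t%:C * x)| by rewrite RRe_real// normr_real.
have off t : 1 <= t -> off_segment (t%:C * x).
  by move=> t1; apply: off_segmentZ => //; rewrite -(rmorph1 (real_complex R)) lecR.
have f0 : f t0 < 1.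
  rewrite -ltcR fE; apply: HM; first exact: off.
  rewrite normrM t0E ger0_norm; last by rewrite addr_ge0// divr_ge0.
  rewrite mulrDl mul1r divfK ?normr_eq0//.
  by rewrite (le_lt_trans (real_ler_norm Mr))// ltrDr normr_gt0.
rewrite -[x]mul1r -fE (ltcR _ 1) ltNge; apply/negP => f1.
have fc : {within `[1, t0], continuous f}.
  apply: continuous_in_subspaceT => t; rewrite inE/= in_itv/= => /andP[t1 _].
  have cx : {for t, continuous (fun t : R => t%:C * x)}.
    by apply: cvgMl; exact: real_complex_continuous.
  exact: (continuous_comp cx (branch_norm_continuous (off t t1))).
have [] := IVT (v := 1) t01 fc.
  by rewrite ge_min le_max f1 (ltW f0) orbT.
move=> t; rewrite in_itv/= => /andP[t1 _] ft.
have := branch_norm_neq1 (off _ t1).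
by rewrite -fE ft eqxx.
Qed.

End Branch.
End ComplexTopology.

(** * Interpolation at the nodes *)

Section Pade.
Variables (R : realType) (s : R[i] -> R[i]) (a : nat -> R[i]).
Hypotheses (s_branch : sqrt_branch s) (a_inj : injective a).
Hypothesis a_off : forall k, off_segment (a k).
Local Notation C := R[i].
Variable n : nat.
Let A := (pade_polys a (s \o a) n).1.
Let B := (pade_polys a (s \o a) n).2.

(** The conjugate A + B s of A - B s, the factor by which the latter is to be
    multiplied to become the product of the (x - a k)^2. *)
Definition conj_prod (x : C) := \prod_(k < n) (a k * x - 1 + s (a k) * s x).
Definition pade_rem (x : C) := (s x * conj_prod x)^-1.

(** The left side is (a k x - 1)^2 - (a k ^ 2 - 1)(x^2 - 1). *)
Lemma conj_factor k x : off_segment x ->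
  (a k * x - 1 + s (a k) * s x) * (a k * x - 1 - s (a k) * s x) = (x - a k) ^+ 2.
Proof.
move=> xo; rewrite mulrC -subr_sqr exprMn (branch_sqr s_branch xo) (branch_sqr s_branch (a_off k)).
ring.
Qed.

Lemma pade_polys_horner x : off_segment x ->
  A.[x] + B.[x] * s x = conj_prod x /\
  A.[x] - B.[x] * s x = \prod_(k < n) (a k * x - 1 - s (a k) * s x).
Proof.
move=> xo; have S2 : s x ^+ 2 = (horner_eval x 'X) ^+ 2 - 1.
  by rewrite /horner_eval hornerX (branch_sqr s_branch xo).
split.
  rewrite (pade_polys_morph (phi := horner_eval x) _ _ _ S2); apply: eq_bigr => k _.
  by rewrite /= /horner_eval !hornerC hornerX.
have S2' : (- s x) ^+ 2 = (horner_eval x 'X) ^+ 2 - 1 by rewrite sqrrN.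
rewrite -mulrN (pade_polys_morph (phi := horner_eval x) _ _ _ S2').
by apply: eq_bigr => k _; rewrite /= /horner_eval !hornerC hornerX mulrN.
Qed.

(** At the node a i the factor of index i is 2 s (a i)^2; any other factor
    divides (a i - a k)^2, which is not 0 as the nodes are distinct. *)
Lemma conj_prod_neq0 i : conj_prod (a i) != 0.
Proof.
apply/prodf_neq0 => k _; have ao := a_off i.
have [->|ki] := eqVneq (k : nat) i.
  by rewrite -!expr2 -(branch_sqr s_branch ao) -mulr2n mulrn_eq0/= expf_neq0//;
    exact: branch_neq0 ao.
have : (a i - a k) ^+ 2 != 0 by rewrite expf_neq0// subr_eq0 (inj_eq a_inj) eq_sym.
by rewrite -(conj_factor _ ao) mulf_eq0 negb_or => /andP[].
Qed.

(** At a node A - B s = 0, so A = 0 would give A + B s = 0. *)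
Lemma pade_den_neq0 i : (i < n)%N -> A.[a i] != 0.
Proof.
move=> ni; have [E1 E2] := pade_polys_horner (a_off i).
apply/negP => /eqP A0; have := conj_prod_neq0 i.
rewrite -E1 A0 add0r -oppr_eq0 -sub0r -{1}A0 E2.
rewrite (bigD1 (Ordinal ni))//= -!expr2 -(branch_sqr s_branch (a_off i)) subrr mul0r.
by rewrite eqxx.
Qed.

Lemma conj_prod_derivable x : off_segment x -> derivable conj_prod x 1.
Proof.
move=> /(branch_derivable s_branch) ds.
exact: (@derivable_conj_prod _ a (s \o a) s n x ds).
Qed.

Lemma pade_rem_derivable x : off_segment x -> conj_prod x != 0 ->
  derivable pade_rem x 1.
Proof.
move=> xo cx; exact: (derivable_invM (branch_neq0 s_branch xo) cx
  (branch_derivable s_branch xo) (conj_prod_derivable xo)).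
Qed.

Lemma conj_prod_near i : \forall x \near a i, off_segment x /\ conj_prod x != 0.
Proof.
have H1 := off_segment_near (a_off i).
have H2 : \forall x \near a i, conj_prod x != 0.
  exact: (derivable_near_neq0 (conj_prod_derivable (a_off i)) (conj_prod_neq0 i)).
exact: filterI H1 H2.
Qed.

(** A / s - B = (A - B s) / s, and multiplying A - B s by its conjugate gives
    the product of the (x - a k)^2. *)
Lemma pade_error x : off_segment x -> conj_prod x != 0 ->
  A.[x] * (s x)^-1 - B.[x] = pade_rem x * \prod_(k < n) (x - a k) ^+ 2.
Proof.
move=> xo cx; have [E1 E2] := pade_polys_horner xo; have s0 := branch_neq0 s_branch xo.
have -> : \prod_(k < n) (x - a k) ^+ 2 = conj_prod x * (A.[x] - B.[x] * s x).
  by rewrite E2 /conj_prod -big_split; apply: eq_bigr => k _ /=; rewrite conj_factor.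
by rewrite /pade_rem; field; rewrite s0 cx.
Qed.

(** Here |c k| < 1 matters: the product C of the c k then has |C| < 1, which
    excludes C^2 = -1 and C^2 = 1, the values at which a degree drops. *)
Lemma branch_polys_size m : n = m.+1 -> size A = n.+1 /\ size B = n.
Proof.
move=> nE; pose c k := a k - s (a k).
have cV k : c k * (a k + s (a k)) = 1 by exact: branch_mul.
have c1 k : `|c k| < 1 by exact: branch_norm_lt1.
have C1 : `|\prod_(k < n) c k| < 1 by rewrite nE; exact: prod_norm_lt1.
by apply: (@pade_polys_exact_size _ a (s \o a) c n) => //; apply: sqr_neq_unit => //;
  rewrite ?normrN normr1.
Qed.

Lemma pade_contact i : (i < n)%N ->
  let phi := fun x => (s x)^-1 in
  let f := rateval (B%:F / A%:F) in
  [/\ derivable phi (a i) 1, derivable f (a i) 1, phi (a i) = f (a i)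
    & derive1 phi (a i) = derive1 f (a i)].
Proof.
move=> ni phi f.
have A0 := pade_den_neq0 ni.
have nA : \forall x \near a i, A.[x] != 0.
  exact: (@derivable_near_neq0 _ (fun x => A.[x]) (a i)
    (@derivable_poly_eval _ A (a i)) A0).
pose g x := B.[x] / A.[x].
have dg : derivable g (a i) 1 by exact: derivable_horner_frac.
have [df fg f'] : [/\ derivable f (a i) 1, f (a i) = g (a i)
    & derive1 f (a i) = derive1 g (a i)].
  apply: (double_contact (h := fun _ => 0) dg).
    exact: derivable_cst.
  by apply: filterS nA => x Ax; rewrite mul0r addr0 /f rateval_frac.
pose q x := \prod_(k < n | k != Ordinal ni) (x - a k) ^+ 2.
have dh : derivable (fun x => pade_rem x * q x / A.[x]) (a i) 1.
  have dr : derivable pade_rem (a i) 1.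
    exact: (pade_rem_derivable (a_off i) (conj_prod_neq0 i)).
  exact: (@derivable_contact_rem _ pade_rem a n
    (fun k => k != Ordinal ni) A (a i) dr A0).
have [dphi phig phi'] : [/\ derivable phi (a i) 1, phi (a i) = g (a i)
    & derive1 phi (a i) = derive1 g (a i)].
  apply: (double_contact dg dh).
  apply: filterS (filterI nA (conj_prod_near i)) => x [Ax [xo cx]].
  have := pade_error xo cx; rewrite (bigD1 (Ordinal ni))//= -/(q x) => E.
  have -> : phi x = B.[x] / A.[x] + (A.[x] * (s x)^-1 - B.[x]) / A.[x].
    by rewrite /phi; have := branch_neq0 s_branch xo => s0; field; rewrite Ax s0.
  by rewrite E /g; ring.
by split; rewrite ?fg ?f'.
Qed.

Lemma prod_flatten_double m x :
  \prod_(b <- flatten [seq [:: a i; a i] | i <- iota 0 m]) (x - b) =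
  \prod_(k < m) (x - a k) ^+ 2.
Proof.
rewrite -(big_mkord xpredT (fun k => (x - a k) ^+ 2)) /index_iota subn0.
elim: (iota 0 m) => [|k r IHr] /=; first by rewrite !big_nil.
by rewrite !big_cons IHr mulrA.
Qed.

Lemma mem_flatten_double m b :
  b \in flatten [seq [:: a i; a i] | i <- iota 0 m] ->
  exists2 i, (i < m)%N & b = a i.
Proof.
case/flatten_mapP => i; rewrite mem_iota => /andP[_ im].
by rewrite !inE orbb => /eqP ->; exists i.
Qed.

Lemma pade_multipoint m : n = m.+1 ->
  multipoint_pade m n (fun x => (s x)^-1)
    (flatten [seq [:: a i; a i] | i <- iota 0 n]) (B%:F / A%:F).
Proof.
move=> nE; split.
  have -> (r : seq nat) : size (flatten [seq [:: a i; a i] | i <- r]) = (size r).*2.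
    by elim: r => //= i r ->.
  by rewrite size_iota -addnn {1}nE.
have [sA sB] := branch_polys_size nE.
exists B, A; split=> //; first by rewrite sB nE.
exists pade_rem => b /mem_flatten_double[i ni ->].
split; apply: filterS (conj_prod_near i) => x [xo cx].
  exact: pade_rem_derivable.
by rewrite prod_flatten_double pade_error.
Qed.

End Pade.

Theorem theorem5p2 (R : realType) (s : R[i] -> R[i]) (a : nat -> R[i])
  (T U : nat -> ratfun R[i]) (n : nat)
  (s_branch : sqrt_branch s)
  (a_inj : injective a)
  (a_off : forall k, off_segment (a k))
  (T_cheb : forall m, is_chebT (fun k => a k - s (a k)) m (T m))
  (U_cheb : forall m, is_chebU (fun k => a k - s (a k)) m (U m))
  (n_gt0 : (0 < n)%N) :
  let phi : R[i] -> R[i] := fun x => (s x)^-1 in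
  let UT : ratfun R[i] := U n.-1 / T n in
  (forall i : nat, (i < n)%N ->
    [/\ derivable phi (a i) 1, derivable (rateval UT) (a i) 1,
        phi (a i) = rateval UT (a i)
      & derive1 phi (a i) = derive1 (rateval UT) (a i)]) /\
  multipoint_pade n.-1 n phi (flatten [seq [:: a i; a i] | i <- iota 0 n]) UT.
Proof.
case: n n_gt0 => [|m] n_gt0; first by discriminate n_gt0.
move=> phi UT.
have two0 : 2%:R != 0 :> R[i] by rewrite pnatr_eq0.
have s2 k : s (a k) ^+ 2 = a k ^+ 2 - 1 by exact: branch_sqr.
have [sA _] := branch_polys_size s_branch a_off (erefl m.+1).
have A0 : (pade_polys a (s \o a) m.+1).1 != 0 by rewrite -size_poly_gt0 sA.
rewrite /UT (cheb_quotient two0 (fun=> erefl) s2 A0 (T_cheb m.+1) (U_cheb m)).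
split; last exact: (pade_multipoint s_branch a_inj a_off (erefl m.+1)).
by move=> i im; exact: (pade_contact s_branch a_inj a_off im).
Qed.
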